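(* Let $q$ be a prime power and let $n\ge 1$. The number of $F$-stable maximal tori of $GL_n(\overline{F_q})$ is equal to $q^{n^2-n}$.
   Context: $F_q$ is the finite field with $q$ elements and $F$ denotes the Frobenius map on $GL_n(\overline{F_q})$ raising each matrix entry to the $q$-th power. A maximal torus $T$ of $GL_n(\overline{F_q})$ is $F$-stable if $F(T)=T$. *)

(* Defs.v *)
From HB Require Import structures.
From mathcomp Require Import all_boot all_algebra.
From mathcomp Require Import boolp classical_sets functions cardinality.
From mathcomp Require mpoly.

Set Implicit Arguments.
Unset Strict Implicit.
Unset Printing Implicit Defensive.

Import GRing.Theory.
Local Open Scope classical_set_scope.
Local Open Scope ring_scope.

(* Algebraic groups are taken in the classical sense: closed subgroups of
   GL_n(K), K algebraically closed, identified with their sets of K-points. *)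
Section AlgebraicGroups.
Variable K : closedFieldType.

Definition GL (n : nat) : set 'M[K]_n := [set A | A \in unitmx].

(* The coordinate ring K[GL_n] = K[x_ij][1/det] consists of the P / det^d. *)
Definition regfun (n : nat) (P : mpoly.mpoly (n * n) K) (d : nat)
    (A : 'M[K]_n) : K :=
  mpoly.meval (fun i => mxvec A 0 i) P / \det A ^+ d.

Definition zariski_closed (n : nat) (X : set 'M[K]_n) : Prop :=
  exists S : set (mpoly.mpoly (n * n) K * nat),
    X = [set A | GL A /\ forall f, S f -> regfun f.1 f.2 A = 0].

Definition subgroup (n : nat) (G : set 'M[K]_n) : Prop :=
  [/\ G `<=` @GL n, G 1%:M,
      forall A B, G A -> G B -> G (A *m B)
    & forall A, G A -> G (invmx A)].

Definition algebraic_subgroup (n : nat) (G : set 'M[K]_n) : Prop :=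
  zariski_closed G /\ subgroup G.

(* As G is closed in the affine variety GL_n, its regular functions are the
   restrictions of the elements of K[GL_n]. *)
Definition regular_on (n : nat) (G : set 'M[K]_n) (f : 'M[K]_n -> K) : Prop :=
  exists (P : mpoly.mpoly (n * n) K) (d : nat),
    forall A, G A -> f A = regfun P d A.

Definition alg_group_morphism (n m : nat) (G : set 'M[K]_n)
    (H : set 'M[K]_m) (phi : 'M[K]_n -> 'M[K]_m) : Prop :=
  [/\ forall A, G A -> H (phi A),
      forall A B, G A -> G B -> phi (A *m B) = phi A *m phi B
    & forall i j, regular_on G (fun A => phi A i j)].

Definition alg_group_isomorphic (n m : nat) (G : set 'M[K]_n)
    (H : set 'M[K]_m) : Prop :=
  exists (phi : 'M[K]_n -> 'M[K]_m) (psi : 'M[K]_m -> 'M[K]_n),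
    [/\ alg_group_morphism G H phi, alg_group_morphism H G psi,
        forall A, G A -> psi (phi A) = A
      & forall B, H B -> phi (psi B) = B].

(* (G_m)^r, as the group of invertible diagonal r x r matrices. *)
Definition diag_group (r : nat) : set 'M[K]_r :=
  [set A | GL A /\ is_diag_mx A].

Definition torus (n : nat) (T : set 'M[K]_n) : Prop :=
  algebraic_subgroup T /\ exists r, alg_group_isomorphic T (@diag_group r).

Definition maximal_torus (n : nat) (T : set 'M[K]_n) : Prop :=
  torus T /\ forall T', torus T' -> T `<=` T' -> T' = T.

Definition frobenius (q n : nat) (A : 'M[K]_n) : 'M[K]_n :=
  map_mx (fun x => x ^+ q) A.

Definition F_stable (q n : nat) (T : set 'M[K]_n) : Prop :=
  @frobenius q n @` T = T.

End AlgebraicGroups.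

Definition prime_power (q : nat) : Prop :=
  exists p k : nat, [/\ prime p, (0 < k)%N & q = (p ^ k)%N].

(* The closed field K is an algebraic closure of k, via iota. *)
Definition algebraic_closure (k : fieldType) (K : closedFieldType)
    (iota : {rmorphism k -> K}) : Prop :=
  forall x : K, algebraicOver iota x.

(* Main.v *)
Require Import Defs.
From HB Require Import structures.
From mathcomp Require Import all_boot all_fingroup all_solvable all_algebra all_field.
From mathcomp Require Import boolp classical_sets functions cardinality.
From mathcomp Require mpoly.
From mathcomp Require Import fintype finset.

Set Implicit Arguments.
Unset Strict Implicit.
Unset Printing Implicit Defensive.

Import GRing.Theory Num.Theory.
Local Open Scope ring_scope.

(** Each diagonal matrix over an algebraic closure of a finite field is fixed by
    a power of the Frobenius.  So every element A of a torus satisfies A^Q = A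
    for some power Q of q; as X^Q - X has simple roots, A is diagonalizable, and
    a torus, being commutative, is diagonalizable as a whole
    ([torus_sub_eigen]).  The maximal tori are therefore the groups
    [eigen_torus g], g invertible, of the invertible matrices for which the rows
    of g are eigenvectors, and such a group determines the rows of g up to order
    and scaling ([eigen_torus_sub]).

    On an F-stable maximal torus the Frobenius permutes the n eigenlines by some
    permutation w.  Rescaling the rows of g along the cycles of w
    ([torus_lang]), one may suppose that row w(i) of g is exactly the Frobenius
    image of row i ([F_stable_maximal_torusP]).  So it suffices to count the
    pairs (w, g) of this kind and to divide by the size of the fibres of
    (w, g) |-> [eigen_torus g].

    For fixed w the solutions f in K^n of f(w(i)) = f(i)^q form an F_q-structure
    on K^n: they span it ([fixpts_separate]), so that the matrices g for w form
    a coset of GL_n(F_q) and there are q^n solutions f.  In a fibre there are n!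
    ways to order the eigenlines; each of them determines w, and then the
    admissible scalings are the solutions f for w without a zero entry.  They
    form the finite torus T_w, of order [torus_order].  Hence the number of
    F-stable maximal tori is |GL_n(F_q)| / n! times the sum of 1 / |T_w| over
    all w ([F_stable_tori_seq]).

    It remains to see that 1/m! times the sum of 1 / |T_w| over the permutations
    w of m points is b_m = \prod_(i < m) q^i / (q^(i+1) - 1).  The support U of
    any of the q^m solutions f for w is stable under w, and
    |T_w| = |T_(w on U)| |T_(w off U)|.  Sorting the solutions by support gives
    q^m / |T_w| = \sum_U 1 / |T_(w off U)|, and summing over w gives
    q^m b_m = b_0 + ... + b_m ([inv_torus_sum_rec]), which determines b_m.
    Multiplying by |GL_n(F_q)| leaves q^(n choose 2) twice, that is
    q^(n^2 - n).

    All the coordinates that occur lie in the field with q^(n!) elements,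
    because w^(n!) = 1; this makes the sets to be counted finite. *)

(** * The Frobenius endomorphism *)

Section Frobenius.
Variables (Fq : finFieldType) (K : closedFieldType) (iota : {rmorphism Fq -> K}).
Local Notation q := #|Fq|.

Lemma card_pchar_nat k : ([pchar K]).-nat (q ^ k)%N.
Proof.
have [p p_pr pF] := finPcharP Fq.
have pK : p \in [pchar K] by rewrite (fmorph_pchar iota).
rewrite (eq_pnat _ (pcharf_eq pK)) pnatX; apply/orP; left.
by have := pprimeChar_pgroup pF; rewrite /pgroup cardsT.
Qed.

Lemma expr0_card k : 0 ^+ (q ^ k) = 0 :> K.
Proof. by rewrite expr0n gtn_eqF // expn_gt0 (ltnW (finNzRing_gt1 Fq)). Qed.

(** The embedding is an argument because it is what makes the map additive, so
    that the morphism instances below can be inferred from it. *)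
Definition frob of {rmorphism Fq -> K} := fun x : K => x ^+ q.

Fact frob_is_zmod : zmod_morphism (frob iota).
Proof.
move=> x y; rewrite /frob; have := card_pchar_nat 1; rewrite expn1 => qP.
by rewrite exprDn_pchar // exprNn_pchar.
Qed.

Fact frob_is_monoid : monoid_morphism (frob iota).
Proof. by split=> [|x y]; rewrite /frob ?expr1n ?exprMn. Qed.

HB.instance Definition _ :=
  GRing.isZmodMorphism.Build K K (frob iota) frob_is_zmod.
HB.instance Definition _ :=
  GRing.isMonoidMorphism.Build K K (frob iota) frob_is_monoid.

(** The q elements of the image of Fq already exhaust the roots of X^q - X. *)
Lemma frob_fixedP x : reflect (exists a, x = iota a) (x ^+ q == x).
Proof.
apply: (iffP eqP) => [xq|[a ->]]; last by rewrite -rmorphXn expf_card.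
have : root (map_poly iota ('X^q - 'X)) x.
  by rewrite rmorphB /= map_polyXn map_polyX /root !hornerE xq subrr.
rewrite finField_genPoly rmorph_prod /=.
under eq_bigr do rewrite rmorphB /= map_polyX map_polyC /=.
rewrite -big_enum /= -(big_map iota predT (fun a => 'X - a%:P)) root_prod_XsubC.
by move=> /mapP[a _ ->]; exists a.
Qed.

(** The polynomial X^(q^k) - X has derivative -1, hence simple roots. *)
Lemma frob_roots_exist k : (0 < k)%N ->
  exists s : seq K, [/\ uniq s, size s = (q ^ k)%N,
      forall x, (x \in s) = (x ^+ (q ^ k) == x)
    & \prod_(x <- s) ('X - x%:P) = 'X^(q ^ k) - 'X].
Proof.
move=> k_gt0; set Q := (q ^ k)%N; pose p : {poly K} := 'X^Q - 'X.
have Q_gt1 : (1 < Q)%N by rewrite -{1}(expn0 q) ltn_exp2l // finNzRing_gt1.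
have szp : size p = Q.+1.
  by rewrite size_polyDl ?size_polyXn // size_polyN size_polyX.
have lp : lead_coef p = 1.
  by rewrite lead_coefDl ?lead_coefXn // size_polyN size_polyX size_polyXn.
have Q0 : Q%:R = 0 :> K.
  have [r r_pr rF] := finPcharP Fq.
  have rK : r \in [pchar K] by rewrite (fmorph_pchar iota).
  have := card_pchar_nat k; rewrite (eq_pnat _ (pcharf_eq rK)) -/Q.
  move=> /p_natP[[|m] E]; first by rewrite E in Q_gt1.
  by rewrite E expnS natrM (pcharf0 rK) mul0r.
have [s ps] := closed_field_poly_normal p; rewrite lp scale1r in ps.
exists s; split.
- rewrite -separable_prod_XsubC -ps separable_poly.unlock.
  rewrite derivB derivXn derivX -mulr_natr -polyC_natr Q0 mulr0 sub0r.
  by rewrite -scaleN1r coprimepZr ?coprimep1 // oppr_eq0 oner_eq0.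
- by have := szp; rewrite ps size_prod_XsubC => -[].
- by move=> x; rewrite -root_prod_XsubC -ps /root !hornerE subr_eq0.
- by rewrite -ps.
Qed.
End Frobenius.

(** * Frobenius-twisted equations along the cycles of a permutation *)

Section TwistedOrbits.
Variables (I : finType) (w : {perm I}) (R : comNzRingType) (q : nat).

(** The value at w^k(r) forced by the value x at r on a function that satisfies
    f(w(j)) = d(j) f(j)^q. *)
Fixpoint twist_iter (d : I -> R) (r : I) (x : R) (k : nat) : R :=
  if k is k'.+1 then d (iter k' w r) * twist_iter d r x k' ^+ q else x.

Lemma twist_iterE d r x k :
  twist_iter d r x k = twist_iter d r 1 k * x ^+ (q ^ k).
Proof.
elim: k => [|k IHk] /=; first by rewrite mul1r expn0 expr1.
by rewrite IHk exprMn mulrA -exprM -expnSr.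
Qed.

Lemma twist_iter1 r k : twist_iter (fun=> 1) r 1 k = 1.
Proof. by elim: k => //= k ->; rewrite expr1n mulr1. Qed.

(** On each cycle the equation propagates the value at the root of the cycle; it
    has a solution once coming back to the root returns the initial value. *)
Lemma twisted_solution (d X : I -> R) :
  (forall r, twist_iter d r (X r) (fingraph.order w r) = X r) ->
  exists f : I -> R, (forall j, f (w j) = d j * f j ^+ q)
    /\ (forall j, f j = let r := froot w j in twist_iter d r (X r) (findex w r j)).
Proof.
move=> dX; eexists; split; last by move=> j.
move=> j; have symw := fconnect_sym (@perm_inj _ w).
have -> /= : froot w (w j) = froot w j.
  by apply/eqP; rewrite root_connect // symw fconnect1.
set r := froot w j; set k := findex w r j.
have rj : fconnect w r j by rewrite symw connect_root.
have jE : j = iter k w r by rewrite iter_findex.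
have k_max : (k < fingraph.order w r)%N by apply: findex_max.
have [kS|] := ltnP k.+1 (fingraph.order w r).
  by rewrite {1}jE -iterS findex_iter //= -jE.
move=> kS; have kE : fingraph.order w r = k.+1 by apply/eqP; rewrite eqn_leq kS.
have -> : w j = r by rewrite {1}jE -iterS -kE iter_order //; apply: perm_inj.
by rewrite findex0 /= -[LHS]dX kE /= -jE.
Qed.

End TwistedOrbits.

(** The surjectivity of the Lang map on a diagonal torus whose Frobenius is
    twisted by w: around a cycle of length m the condition reads
    c x^(q^m) = x with c nonzero, which has a nonzero root. *)
Lemma torus_lang (I : finType) (w : {perm I}) (K : closedFieldType) (q : nat)
  (d : I -> K) : (1 < q)%N -> (forall i, d i != 0) ->
  exists f : I -> K, (forall i, f i != 0) /\ (forall i, f (w i) = d i * f i ^+ q).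
Proof.
move=> q_gt1 d0.
have c0 r k : twist_iter w q d r 1 k != 0.
  by elim: k => [|k IHk] /=; rewrite ?oner_eq0 // mulf_neq0 ?expf_neq0.
have root_ex r : exists x, (x != 0) && (twist_iter w q d r x (fingraph.order w r) == x).
  set c := twist_iter w q d r 1 (fingraph.order w r); set Q := (q ^ fingraph.order w r)%N.
  have Q_gt1 : (1 < Q)%N by rewrite -{1}(expn0 q) ltn_exp2l // fingraph.order_gt0.
  have /closed_rootP[x] : size (c *: 'X^(Q.-1) - 1) != 1%N.
    have cn : c != 0 by apply: c0.
    have szc : size (c *: 'X^(Q.-1)) = Q.
      by rewrite size_scale // size_polyXn (ltn_predK Q_gt1).
    by rewrite size_polyDl szc ?size_polyN ?size_poly1 // gtn_eqF.
  rewrite /root !hornerE subr_eq0 => /eqP cx.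
  have x0 : x != 0.
    apply: contra_eq_neq cx => ->; rewrite expr0n.
    by case: (Q) Q_gt1 => [|[|m]] //= _; rewrite mulr0 eq_sym oner_eq0.
  exists x; rewrite x0 twist_iterE -/c -/Q /= -(ltn_predK Q_gt1) exprSr mulrA.
  by rewrite cx mul1r.
pose X r := xchoose (root_ex r).
have XP r : (X r != 0) /\ (twist_iter w q d r (X r) (fingraph.order w r) = X r).
  by have /andP[? /eqP ?] := xchooseP (root_ex r).
have [f [f1 f2]] := twisted_solution (fun r => (XP r).2).
exists f; split=> // i; rewrite f2 /= twist_iterE mulf_neq0 // expf_neq0 //.
exact: (XP _).1.
Qed.

(** * The rational structure on K^n attached to a permutation *)

Lemma card_unitmx (F : finFieldType) (n : nat) : (0 < n)%N ->
  #|[set h : 'M[F]_n | h \in unitmx]|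
  = (#|F| ^ 'C(n, 2) * \prod_(1 <= i < n.+1) (#|F| ^ i - 1))%N.
Proof.
case: n => // n _; rewrite -card_GL // cardsT card_sub.
by apply: eq_card => h; rewrite !inE.
Qed.

Section TwistedPoints.
Variables (Fq : finFieldType) (K : closedFieldType) (iota : {rmorphism Fq -> K}).
Local Notation q := #|Fq|.
Variables (n : nat) (rs : seq K).
(* rs lists the subfield with q^(n!) elements. *)
Hypothesis rsP : forall x, (x \in rs) = (x ^+ (q ^ n`!) == x).
Local Notation L := (seq_sub rs).
Implicit Types (w : {perm 'I_n}).

Lemma map_val_inj m : injective (map_mx val : 'M[L]_(n, m) -> 'M[K]_(n, m)).
Proof.
move=> A B /matrixP AB; apply/matrixP => i j; apply: val_inj.
by have := AB i j; rewrite !mxE.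
Qed.

(** The points of K^n fixed by the Frobenius twisted by w; their coordinates lie
    in rs by [twisted_in_rs]. *)
Definition fixpts w : {set {ffun 'I_n -> L}} :=
  [set f : {ffun 'I_n -> L} | [forall i, val (f (w i)) == val (f i) ^+ q]].

(** Going n! times around w is the identity, and raises each value to the power
    q^(n!). *)
Lemma twisted_in_rs w (f : 'I_n -> K) :
  (forall i, f (w i) = f i ^+ q) -> forall i, f i \in rs.
Proof.
move=> fw i; rewrite rsP.
have iterE k : f (iter k w i) = f i ^+ (q ^ k).
  by elim: k => [|k IHk] //=; rewrite ?expr1 // fw IHk -exprM -expnSr.
have wN : (w ^+ n`! = 1)%g.
  apply/eqP; rewrite -order_dvdn -card_Sn -cardsT.
  by apply: (order_dvdG (G := [group of [set: {perm 'I_n}]])); rewrite inE.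
by rewrite -iterE -permX wN perm1.
Qed.

Lemma fixptsP w (f : 'I_n -> K) : (forall i, f (w i) = f i ^+ q) ->
  exists2 h, h \in fixpts w & forall i, val (h i) = f i.
Proof.
move=> fw; have frs := twisted_in_rs fw.
exists [ffun i => SeqSub (frs i)]; last by move=> i; rewrite ffunE.
by rewrite inE; apply/forallP => i; rewrite !ffunE /= fw.
Qed.

(** No nonzero linear form kills the twisted fixed points.  On a cycle of length m
    with root r, the points supported on the cycle are x, x^q, ..., x^(q^(m-1))
    with x^(q^m) = x; a linear form vanishing on them is a polynomial in x of
    degree at most q^(m-1) with q^m roots. *)
Lemma fixpts_separate w (c : 'I_n -> K) :
  (forall f, f \in fixpts w -> \sum_j c j * val (f j) = 0) -> forall j, c j = 0.
Proof.
move=> cf j0; have symw := fconnect_sym (@perm_inj _ w).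
set r := froot w j0; set m := fingraph.order w r.
have m_gt0 : (0 < m)%N by apply: fingraph.order_gt0.
pose p : {poly K} := \sum_(j | froot w j == r) c j *: 'X^(q ^ findex w r j).
have q_gt1 : (1 < q)%N := finNzRing_gt1 Fq.
have rr : froot w r = r by apply: root_root.
have in_orb j : froot w j == r -> fconnect w r j.
  by move/eqP=> <-; rewrite symw connect_root.
have p0 x : x ^+ (q ^ m) = x -> p.[x] = 0.
  move=> xm; pose X s : K := if s == r then x else 0.
  have [s|f [f1 f2]] := @twisted_solution _ w _ q (fun=> 1) X.
    rewrite twist_iterE twist_iter1 mul1r /X; case: eqP => [->//|_].
    by rewrite expr0_card.
  have [j|h hw hE] := @fixptsP w f; first by rewrite f1 mul1r.
  rewrite -(cf h hw) (bigID (fun j => froot w j == r)) /= [X in _ + X]big1 ?addr0.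
    rewrite /p horner_sum; apply: eq_bigr => j jr.
    by rewrite hE f2 /= (eqP jr) twist_iterE twist_iter1 mul1r /X eqxx hornerZ hornerXn.
  move=> j jr; rewrite hE f2 /= twist_iterE /X (negPf jr).
  by rewrite expr0_card !mulr0.
have pz : p = 0.
  have [s [us szs smem _]] := frob_roots_exist iota m_gt0.
  apply: (@roots_geq_poly_eq0 _ p s) => //.
    by apply/allP => x; rewrite smem => /eqP /p0 px; apply/rootP.
  rewrite szs; apply: leq_trans (size_sum _ _ _) _; apply/bigmax_leqP => j jr.
  apply: leq_trans (size_scale_leq _ _) _; rewrite size_polyXn ltn_exp2l //.
  by apply: findex_max; apply: in_orb.
have := congr1 (fun P : {poly K} => P`_(q ^ findex w r j0)) pz.
rewrite /p coef_sum coef0 (bigD1 j0) ?eqxx //= big1 ?addr0.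
  by rewrite coefZ coefXn eqxx mulr1.
move=> j /andP[jr jj0]; rewrite coefZ coefXn eqn_exp2l //.
case: eqP => [E|_]; last by rewrite mulr0.
case/eqP: jj0; rewrite -(iter_findex (in_orb _ jr)) -E iter_findex //.
by apply: in_orb; rewrite /r.
Qed.

(** The twisted fixed points span K^n, so n of them are the columns of an
    invertible matrix: the surjectivity of the Lang map of GL_n at the
    permutation matrix of w. *)
Lemma twisted_unitmx_exists w :
  exists2 g : 'M[K]_n, g \in unitmx & forall i j, g (w i) j = g i j ^+ q.
Proof.
pose M : 'M[K]_(#|fixpts w|, n) := \matrix_(i, j) val ((enum_val i : {ffun 'I_n -> L}) j).
have fM : row_full M.
  rewrite -cokermx_eq0; apply/eqP/matrixP => i j; rewrite [RHS]mxE.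
  apply: (fixpts_separate (w := w) (c := fun i => cokermx M i j)) => f fw.
  have := congr1 (fun A : 'M_(_, _) => A (enum_rank_in fw f) j) (mulmx_coker M).
  (* Row f of M times column j of the cokernel. *)
  rewrite /= [LHS]mxE [RHS]mxE; apply: etrans; apply: eq_bigr => k _.
  by rewrite [M _ _]mxE enum_rankK_in // mulrC.
exists (rowsub (fullrankfun fM) M)^T; first by rewrite unitmx_tr fullrowsub_unit.
move=> i j; rewrite !mxE.
by have := enum_valP (fullrankfun fM j); rewrite inE => /forallP /(_ i) /eqP ->.
Qed.

Section Parametrization.
Variables (w : {perm 'I_n}) (g0 : 'M[K]_n).
Hypothesis g0U : g0 \in unitmx.
Hypothesis g0w : forall i j, g0 (w i) j = g0 i j ^+ q.

(** Two solutions of the same twisted equation differ by a matrix fixed by the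
    Frobenius. *)
Lemma twisted_mxP m (A : 'M[K]_(n, m)) :
  (forall i j, A (w i) j = A i j ^+ q) <->
  exists h : 'M[Fq]_(n, m), A = g0 *m map_mx iota h.
Proof.
pose Fr := frob iota.
have twE k (B : 'M[K]_(n, k)) : (forall i j, B (w i) j = B i j ^+ q) <->
    map_mx Fr B = row_perm w B.
  split=> [Bw|E i j]; first by apply/matrixP => i j; rewrite !mxE Bw.
  by have /matrixP /(_ i j) := E; rewrite !mxE => <-.
have g0F : map_mx Fr g0 = row_perm w g0 by apply/twE.
rewrite twE; split=> [AF|[h ->]].
  pose B := invmx g0 *m A.
  have BF : map_mx Fr B = B.
    have gB : g0 *m B = A by rewrite mulKVmx.
    apply: (can_inj (mulKmx g0U)); apply: (can_inj (mulKmx (unitmx_perm K w))).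
    by rewrite mulmxA -row_permE -g0F -map_mxM gB AF row_permE.
  pose h : 'M[Fq]_(n, m) := map_mx (fun x => odflt 0 [pick a | x == iota a]) B.
  exists h; suff <- : B = map_mx iota h by rewrite mulKVmx.
  apply/matrixP => i j; rewrite [RHS]mxE [h i j]mxE; case: pickP => [a /eqP//|/= noa].
  have /matrixP /(_ i j) := BF; rewrite [LHS]mxE => /eqP /(frob_fixedP iota)[a Ba].
  by have /eqP := noa a.
rewrite map_mxM g0F row_permE -mulmxA -row_permE; congr (row_perm _ (_ *m _)).
by apply/matrixP => i j; rewrite !mxE; apply/eqP/(frob_fixedP iota); exists (h i j).
Qed.

(** Used for invertible square matrices and for single columns. *)
Lemma card_twisted_mx m (P : pred 'M[K]_(n, m)) :
  #|[set A : 'M[L]_(n, m) | P (map_mx val A) &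
       [forall i, forall j, val (A (w i) j) == val (A i j) ^+ q]]|
  = #|[set h : 'M[Fq]_(n, m) | P (g0 *m map_mx iota h)]|.
Proof.
have z0 : 0 \in rs.
  by rewrite rsP expr0_card.
pose G (h : 'M[Fq]_(n, m)) : 'M[L]_(n, m) :=
  map_mx (insubd (SeqSub z0)) (g0 *m map_mx iota h).
have GE h : map_mx val (G h) = g0 *m map_mx iota h.
  apply/matrixP => i j; rewrite mxE [G h i j]mxE insubdK //.
  have /twisted_mxP hw :
    exists h', g0 *m map_mx iota h = g0 *m map_mx iota h' by exists h.
  exact: (@twisted_in_rs w (fun i => (g0 *m map_mx iota h) i j)).
have Ginj : injective G.
  move=> h h' /(congr1 (map_mx val)); rewrite !GE => /(can_inj (mulKmx g0U)).
  exact: map_mx_inj.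
rewrite -(card_imset _ Ginj); apply: eq_card => A; rewrite inE.
apply/andP/imsetP => [[PA /forallP Aw]|[h]].
  have /twisted_mxP[h hE] : forall i j, map_mx val A (w i) j = map_mx val A i j ^+ q.
    by move=> i j; rewrite !mxE; apply/eqP/(forallP (Aw i)).
  exists h; first by rewrite inE -hE.
  by apply: map_val_inj; rewrite GE.
rewrite inE => Ph ->; rewrite GE; split=> //.
have /twisted_mxP hw :
  exists h', g0 *m map_mx iota h = g0 *m map_mx iota h' by exists h.
apply/forallP => i; apply/forallP => j.
by have := hw i j; rewrite -GE !mxE => ->.
Qed.

End Parametrization.

Lemma card_fixpts w : #|fixpts w| = (q ^ n)%N.
Proof.
have [g0 g0U g0w] := twisted_unitmx_exists w.
have := card_twisted_mx g0U g0w (m := 1) predT.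
rewrite [RHS](_ : _ = #|{: 'M[Fq]_(n, 1)}|); last by apply: eq_card => h; rewrite !inE.
rewrite card_mx muln1 => <-.
pose H (A : 'M[L]_(n, 1)) : {ffun 'I_n -> L} := [ffun i => A i 0].
have Hinj : injective H.
  by move=> A B /ffunP AB; apply/matrixP => i j; have := AB i; rewrite !ffunE (ord1 j).
rewrite -(card_imset _ Hinj); apply: eq_card => f; rewrite inE.
apply/forallP/imsetP => [fw|[A]].
  exists (\col_i f i); last by apply/ffunP => i; rewrite ffunE mxE.
  by rewrite inE; apply/forallP => i; apply/forallP => j; rewrite !mxE.
by rewrite inE /= => /forallP Aw -> i; rewrite !ffunE; apply/(forallP (Aw i)).
Qed.

Definition twisted_units w : {set 'M[L]_n} :=
  [set A | map_mx val A \in unitmx &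
     [forall i, forall j, val (A (w i) j) == val (A i j) ^+ q]].

Lemma card_twisted_units w : (0 < n)%N ->
  #|twisted_units w| = (q ^ 'C(n, 2) * \prod_(1 <= i < n.+1) (q ^ i - 1))%N.
Proof.
move=> n_gt0; rewrite -card_unitmx //.
have [g0 g0U g0w] := twisted_unitmx_exists w.
rewrite /twisted_units (card_twisted_mx g0U g0w [in unitmx]).
by apply: eq_card => h; rewrite !inE unitmx_mul g0U map_unitmx.
Qed.

End TwistedPoints.

(** * Orders of the finite tori of GL_n *)

Section TorusOrders.
Variables (Fq : finFieldType) (K : closedFieldType) (iota : {rmorphism Fq -> K}).
Local Notation q := #|Fq|.
Variables (n : nat) (rs : seq K).
Hypothesis rsP : forall x, (x \in rs) = (x ^+ (q ^ n`!) == x).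
Local Notation L := (seq_sub rs).
Local Notation fixpts w := (@fixpts Fq K n rs w).
Implicit Types (w v : {perm 'I_n}) (A U : {set 'I_n}).

Definition supp (f : {ffun 'I_n -> L}) : {set 'I_n} := [set i | val (f i) != 0].

Definition stable w A := [forall i, (w i \in A) == (i \in A)].

(** For A stable under w: the order of the twisted torus T_w attached to the
    restriction of w to A, the product of q^c - 1 over its cycle lengths c.
    All subsets of the same index set are treated at once, so that no
    permutation has to be moved to another type. *)
Definition torus_order A w : nat := #|[set f in fixpts w | supp f == A]|.

Lemma stableE w A i : stable w A -> (w i \in A) = (i \in A).
Proof. by move=> /forallP /(_ i) /eqP. Qed.

Lemma stableD w A U : stable w A -> stable w U -> stable w (A :\: U).
Proof. by move=> wA wU; apply/forallP => i; rewrite !inE !stableE. Qed.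

Lemma stable_perm_on w A U : perm_on A w -> A \subset U -> stable w U.
Proof.
move=> wA AU; apply/forallP => i; have [iA|iA] := boolP (i \in A).
  by rewrite !(subsetP AU) // perm_closed.
by rewrite (out_perm wA).
Qed.

Lemma fixpts_eq w f i : f \in fixpts w -> val (f (w i)) = val (f i) ^+ q.
Proof. by rewrite inE => /forallP /(_ i) /eqP. Qed.

Lemma stable_supp w f : f \in fixpts w -> stable w (supp f).
Proof.
move=> fw; apply/forallP => i; rewrite !inE (fixpts_eq i fw) expf_eq0.
by rewrite (ltnW (finNzRing_gt1 Fq)).
Qed.

(** A twisted fixed point is the same as one on U and one off U.  The two
    conditions on supports serve both for points with full support and for
    arbitrary points. *)
Lemma card_fixpts_glue w U (P1 P2 : pred {set 'I_n}) : stable w U ->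
  #|[set f in fixpts w | P1 (supp f :&: U) && P2 (supp f :\: U)]|
  = (#|[set f in fixpts w | (supp f \subset U) && P1 (supp f)]|
     * #|[set f in fixpts w | (supp f \subset ~: U) && P2 (supp f)]|)%N.
Proof.
move=> wU; rewrite -cardsX.
pose G (p : {ffun 'I_n -> L} * {ffun 'I_n -> L}) : {ffun 'I_n -> L} :=
  [ffun i => if i \in U then p.1 i else p.2 i].
have z0 : 0 \in rs by rewrite rsP expr0_card.
have out f (V : {set 'I_n}) i : supp f \subset V -> i \notin V -> val (f i) = 0.
  by move=> fV; apply: contraNeq => fi; apply: (subsetP fV); rewrite inE.
have Ginj : {in setX [set f in fixpts w | (supp f \subset U) && P1 (supp f)]
    [set f in fixpts w | (supp f \subset ~: U) && P2 (supp f)] &, injective G}.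
  move=> [f1 f2] [g1 g2]; rewrite !inE /=.
  move=> /andP[/and3P[_ f1U _] /and3P[_ f2U _]] /andP[/and3P[_ g1U _] /and3P[_ g2U _]].
  move=> /ffunP E; congr (_, _); apply/ffunP => i; have := E i; rewrite !ffunE /=.
    by case: ifPn => // iU _; apply: val_inj; rewrite (out _ _ _ f1U) ?(out _ _ _ g1U).
  case: ifP => // iU _; apply: val_inj.
  by rewrite (out _ _ _ f2U) ?(out _ _ _ g2U) // inE iU.
rewrite -(card_in_imset Ginj); apply: eq_card => f; rewrite inE.
apply/andP/imsetP => [[fw /andP[P1f P2f]]|[[f1 f2]]].
  pose r (V : {set 'I_n}) : {ffun 'I_n -> L} :=
    [ffun i => if i \in V then f i else SeqSub z0].
  have rfix V : stable w V -> r V \in fixpts w.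
    move=> wV; rewrite inE; apply/forallP => i; rewrite !ffunE (stableE _ wV).
    by case: ifP => _; rewrite ?(fixpts_eq _ fw) //= -[q]expn1 expr0_card.
  have rsupp V : supp (r V) = supp f :&: V.
    by apply/setP => i; rewrite !inE ffunE; case: ifP => _; rewrite ?andbT ?andbF ?eqxx.
  have wCU : stable w (~: U) by apply/forallP => i; rewrite !inE (stableE _ wU).
  exists (r U, r (~: U)).
    by rewrite inE /= ![_ \in [set _ in _ | _]]inE !rfix // !rsupp !subsetIr P1f -setDE P2f.
  by apply/ffunP => i; rewrite !ffunE inE; case: ifP => // ->.
rewrite inE /= ![_ \in [set _ in _ | _]]inE.
move=> /andP[/and3P[f1w f1U P1f] /and3P[f2w f2U P2f]] ->.
have -> : supp (G (f1, f2)) :&: U = supp f1.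
  apply/setP => i; rewrite !inE ffunE /=; case: ifPn => iU; rewrite ?andbT //.
  by rewrite andbF (out _ _ _ f1U) // eqxx.
have -> : supp (G (f1, f2)) :\: U = supp f2.
  apply/setP => i; rewrite !inE ffunE /=; case: ifP => iU //.
  by rewrite (out _ _ _ f2U) ?eqxx // inE iU.
rewrite P1f P2f; split=> //; rewrite inE; apply/forallP => i.
by rewrite !ffunE /= (stableE _ wU); case: ifP => _; rewrite fixpts_eq.
Qed.

Lemma torus_order_split w A U : stable w U -> U \subset A ->
  torus_order A w = (torus_order U w * torus_order (A :\: U) w)%N.
Proof.
move=> wU UA; have := card_fixpts_glue (pred1 U) (pred1 (A :\: U)) wU.
rewrite /torus_order => E; apply: etrans (etrans E _).
  apply: eq_card => f; rewrite !inE; congr (_ && _).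
  apply/eqP/andP => [->|[/eqP fU /eqP fD]]; first by rewrite (setIidPr UA) !eqxx.
  by rewrite -(setID (supp f) U) fU fD setDE setUIr setUCr setIT (setUidPr UA).
congr (_ * _)%N; apply: eq_card => f; rewrite !inE /=; congr (_ && _).
  by case: eqP => [->|]; rewrite ?subxx // andbF.
by case: eqP => [->|]; rewrite ?andbF // setDE subsetIr.
Qed.

Lemma torus_order_eq w v A : stable w A -> stable v A -> {in A, w =1 v} ->
  torus_order A w = torus_order A v.
Proof.
move=> wA vA wv; apply: eq_card => f; rewrite !inE.
apply: andb_id2r => /eqP fA; apply: eq_forallb => i.
have [iA|iA] := boolP (i \in A); first by rewrite wv.
have f0 j : j \notin A -> val (f j) = 0.
  by rewrite -fA inE negbK => /eqP.
by rewrite !f0 ?stableE.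
Qed.

(** The indicator function of A is a point of the torus. *)
Lemma torus_order_gt0 w A : stable w A -> (0 < torus_order A w)%N.
Proof.
move=> wA; have z0 : 0 \in rs by rewrite rsP expr0_card.
have z1 : 1 \in rs by rewrite rsP expr1n.
apply/card_gt0P; exists [ffun i => if i \in A then SeqSub z1 else SeqSub z0].
rewrite !inE; apply/andP; split.
  apply/forallP => i; rewrite !ffunE (stableE _ wA).
  by case: ifP => _ /=; rewrite ?expr1n // -[q]expn1 expr0_card.
apply/eqP/setP => i; rewrite inE ffunE.
by case: ifP => _; rewrite /= ?eqxx ?oner_eq0.
Qed.

Lemma card_supp_fixed w A : perm_on (~: A) w ->
  #|[set f in fixpts w | supp f \subset A]| = (q ^ #|A|)%N.
Proof.
move=> wA; have z0 : 0 \in rs by rewrite rsP expr0_card.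
have iota_rs a : iota a \in rs.
  rewrite rsP; elim: n`! => [|k IHk]; first by rewrite expr1.
  by rewrite expnSr exprM (eqP IHk) -rmorphXn expf_card.
pose G (f : {ffun 'I_n -> Fq}) : {ffun 'I_n -> L} := [ffun i => SeqSub (iota_rs (f i))].
have Ginj : injective G.
  move=> f g /ffunP E; apply/ffunP => i; have := E i; rewrite !ffunE.
  by move=> /(congr1 val) /= /fmorph_inj.
rewrite -(card_pffun_on 0 (mem A) predT) -(card_imset _ Ginj) /=; apply: eq_card => f.
have wC i : i \in A -> w i = i by move=> iA; rewrite (out_perm wA) // inE iA.
rewrite inE; apply/andP/imsetP => [[fw fA]|[h]].
  have /fin_all_exists[h hE] i : exists a, val (f i) = iota a.
    have [iA|iA] := boolP (i \in A).
      by apply/(frob_fixedP iota); rewrite -(fixpts_eq _ fw) wC.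
    exists 0; rewrite rmorph0; apply: contraNeq iA => fi; apply: (subsetP fA).
    by rewrite inE.
  exists (finfun h); last by apply/ffunP => i; apply: val_inj; rewrite !ffunE.
  apply/pffun_onP; split=> //; apply/subsetP => i; rewrite inE ffunE => hi.
  by apply: (subsetP fA); rewrite inE hE fmorph_eq0.
move=> /pffun_onP[/subsetP hA _] ->; split; last first.
  apply/subsetP => i; rewrite inE ffunE /= fmorph_eq0 => hi.
  by apply: hA; rewrite inE.
rewrite inE; apply/forallP => i; rewrite !ffunE /=.
have [iA|iA] := boolP (i \in A); first by rewrite wC // -rmorphXn expf_card.
have h0 j : j \notin A -> h j = 0.
  by apply: contraNeq => hj; apply: hA; rewrite inE.
have wiA : w i \notin A by have := perm_closed i wA; rewrite !inE iA => ->.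
by rewrite !h0 // rmorph0 -[q]expn1 expr0_card.
Qed.

(** There are q^n points in all; where w is trivial they are just the functions
    to F_q, and these account for the factor q^(n - |A|). *)
Lemma card_supp_sub w A : perm_on A w ->
  #|[set f in fixpts w | supp f \subset A]| = (q ^ #|A|)%N.
Proof.
move=> wA; have := card_fixpts_glue predT predT (stable_perm_on wA (subxx _)).
have q_gt0 : (0 < q)%N := ltnW (finNzRing_gt1 Fq).
rewrite [LHS](_ : _ = q ^ n)%N; last first.
  by rewrite -(card_fixpts iota rsP w); apply: eq_card => f; rewrite !inE /= andbT.
have -> : #|[set f in fixpts w | supp f \subset ~: A & predT (supp f)]| = (q ^ #|~: A|)%N.
  rewrite -(card_supp_fixed (w := w)) ?setCK //.
  by apply: eq_card => f; rewrite !inE andbT.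
rewrite -{1}[n]card_ord -(cardC (mem A)) expnD.
have -> : #|[predC A]| = #|~: A| by apply: eq_card => i; rewrite !inE.
move/eqP; rewrite eqn_pmul2r ?expn_gt0 ?q_gt0 // => /eqP ->.
by apply: eq_card => f; rewrite !inE andbT.
Qed.

(** Sort the points by their support, which is stable under w. *)
Lemma sum_torus_order w A : perm_on A w ->
  (\sum_(U : {set 'I_n} | (U \subset A) && stable w U) torus_order U w = q ^ #|A|)%N.
Proof.
move=> wA; rewrite -(card_supp_sub wA) -sum1_card.
rewrite (partition_big supp (fun U => (U \subset A) && stable w U)) /=.
  apply: eq_bigr => U /andP[UA _]; rewrite /torus_order -sum1_card.
  apply: eq_bigl => f; rewrite !inE -andbA; congr (_ && _).
  by case: eqP => [->|]; rewrite ?andbF // UA.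
by move=> f; rewrite inE => /andP[fw ->]; rewrite stable_supp.
Qed.

(** Divide the preceding count by |T_w| = |T_(w on U)| |T_(w off U)|. *)
Lemma sum_inv_torus_order w A : perm_on A w ->
  (q ^ #|A|)%:R / (torus_order A w)%:R
  = \sum_(U : {set 'I_n} | (U \subset A) && stable w U)
      ((torus_order (A :\: U) w)%:R)^-1 :> rat.
Proof.
move=> wA; rewrite -(sum_torus_order wA) natr_sum mulr_suml.
have wAA := stable_perm_on wA (subxx _).
apply: eq_bigr => U /andP[UA wU]; rewrite (torus_order_split wU UA) natrM invfM.
by rewrite mulVKf // pnatr_eq0 -lt0n torus_order_gt0.
Qed.

Definition inv_torus_sum A : rat :=
  \sum_(w : {perm 'I_n} | perm_on A w) ((torus_order A w)%:R)^-1.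

(** A permutation of A that preserves U is a permutation of U times one of the
    complement, and the summand sees only the latter. *)
Lemma sum_stable_perm A U : U \subset A ->
  \sum_(w : {perm 'I_n} | perm_on A w && stable w U) ((torus_order (A :\: U) w)%:R)^-1
  = ((#|U|)`!)%:R * inv_torus_sum (A :\: U).
Proof.
move=> UA; set D := A :\: U.
have UD x : x \in U -> x \notin D by move=> xU; rewrite !inE xU.
have DU x : x \in D -> x \notin U by rewrite inE => /andP[].

transitivity (\sum_(u | perm_on U u) \sum_(v | perm_on D v)
    ((torus_order D v)%:R)^-1 : rat); last first.
  by rewrite sumr_const -card_perm [RHS]mulr_natl.
rewrite pair_big /=.
have stabN w V : stable w V -> w \in 'N(V | 'P)%g.
  by move=> wV; apply/astabsP => x /=; rewrite apermE stableE.
rewrite (reindex_onto (fun p : {perm 'I_n} * {perm 'I_n} => (p.1 * p.2)%g)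
  (fun w => (restr_perm U w, restr_perm D w))) /=; last first.
  move=> w /andP[wA wU]; apply/permP => x; rewrite permM.
  have wD : stable w D by apply: stableD => //; apply: stable_perm_on wA _.
  have [xU|xU] := boolP (x \in U).
    rewrite (restr_permE (stabN _ _ wU) xU) (out_perm (restr_perm_on D w)) //.
    by apply: UD; rewrite stableE.
  rewrite [restr_perm U w x](out_perm (restr_perm_on U w)) //.
  have [xD|xD] := boolP (x \in D); first by rewrite (restr_permE (stabN _ _ wD) xD).
  rewrite (out_perm (restr_perm_on D w)) // (out_perm wA) //.
  by apply: contra xD; rewrite inE xU.
have mulUE u v x : perm_on D v -> perm_on U u -> x \in U -> (u * v)%g x = u x.
  by move=> vD uU xU; rewrite permM (out_perm vD) // UD // perm_closed.
have mulDE u v x : perm_on D v -> perm_on U u -> x \notin U -> (u * v)%g x = v x.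
  by move=> vD uU xU; rewrite permM (out_perm uU).
have mul_on u v : perm_on D v -> perm_on U u -> perm_on A (u * v)%g.
  move=> vD uU; apply/fintype.subsetP => x; rewrite inE => ne.
  apply: contraNT ne => xA; rewrite permM (out_perm uU); last first.
    by apply: contra xA; apply/fintype.subsetP.
  by rewrite (out_perm vD) // inE negb_and xA orbT.
have mul_st u v : perm_on D v -> perm_on U u -> stable (u * v)%g U.
  move=> vD uU; apply/forallP => x; have [xU|xU] := boolP (x \in U).
    by rewrite mulUE // perm_closed // xU.
  rewrite mulDE //; apply/eqP/negbTE; have [xD|xD] := boolP (x \in D).
    by apply: DU; rewrite perm_closed.
  by rewrite (out_perm vD).
apply: eq_big => [[u v]|[u v]] /=.
  apply/andP/andP => [[/andP[uvA uvU] /eqP[<- <-]]|[uU vD]].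
    by rewrite !restr_perm_on.
  rewrite mul_on // mul_st //; split=> //.
  have sU := mul_st _ _ vD uU.
  have sD : stable (u * v)%g D.
    by apply: stableD => //; apply: (stable_perm_on (mul_on _ _ vD uU)).
  apply/eqP; congr (_, _); apply/permP => x.
    have [xU|xU] := boolP (x \in U).
      by rewrite (restr_permE (stabN _ _ sU) xU) mulUE.
    by rewrite (out_perm (restr_perm_on U _)) // (out_perm uU).
  have [xD|xD] := boolP (x \in D).
    by rewrite (restr_permE (stabN _ _ sD) xD) mulDE // DU.
  by rewrite (out_perm (restr_perm_on D _)) // (out_perm vD).
move=> /andP[/andP[uvA uvU] /eqP[uE vE]].
have uU : perm_on U u by rewrite -uE restr_perm_on.
have vD : perm_on D v by rewrite -vE restr_perm_on.
congr ((_%:R)^-1); apply: torus_order_eq.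
  by apply: stableD => //; apply: (stable_perm_on uvA).
  exact: stable_perm_on vD _.
by move=> x xD; rewrite mulDE // DU.
Qed.

(** Sum [sum_inv_torus_order] over w and exchange the sums. *)
Lemma inv_torus_sum_rec A :
  (q ^ #|A|)%:R * inv_torus_sum A
  = \sum_(U : {set 'I_n} | U \subset A) ((#|U|)`!)%:R * inv_torus_sum (A :\: U).
Proof.
rewrite mulr_sumr (eq_bigr _ (fun w => @sum_inv_torus_order w A)).
rewrite (exchange_big_dep (fun U : {set 'I_n} => U \subset A)) /=; last first.
  by move=> w U _ /andP[].
by apply: eq_bigr => U UA; rewrite -sum_stable_perm //; apply: eq_bigl => w; rewrite UA.
Qed.

(** This is q^(m^2 - m) / |GL_m(F_q)|, the value that the number of F-stable
    maximal tori takes after division by the order of the group. *)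
Definition torus_mass (m : nat) : rat :=
  \prod_(i < m) ((q ^ i)%:R / ((q ^ i.+1)%:R - 1)).
Local Notation b := torus_mass.

Lemma card_exp_sub1_neq0 m : (q ^ m.+1)%:R - 1 != 0 :> rat.
Proof.
rewrite subr_eq0 (eqr_nat _ _ 1%N) gtn_eqF // -(expn0 q) ltn_exp2l //.
exact: finNzRing_gt1.
Qed.

(** The relation q^m b_m = b_0 + ... + b_m, with b_m taken to the left. *)
Lemma torus_mass_sum m :
  ((q ^ m)%:R - 1) * b m = \sum_(k < m) b k.
Proof.
elim: m => [|m IHm]; first by rewrite big_ord0 expn0 subrr mul0r.
rewrite big_ord_recr /= -IHm {1}/b big_ord_recr /= -/(b m) mulrCA.
by rewrite [_ * (_ / _)]mulrC divfK ?card_exp_sub1_neq0 // mulrBl mul1r subrK mulrC.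
Qed.

(** Induction on |A|: the term U = set0 of [inv_torus_sum_rec] is the sum at A
    itself, and the terms with |U| = k > 0 contribute
    C(m, k) k! (m - k)! b_(m - k) = m! b_(m - k), where m = |A|. *)
Lemma inv_torus_sumE A : inv_torus_sum A = ((#|A|)`!)%:R * b #|A|.
Proof.
have [m] := ubnP #|A|; elim: m A => // m IHm A; rewrite ltnS => Am.
have [/eqP|A_gt0] := posnP #|A|.
  rewrite cards_eq0 => /eqP ->; rewrite cards0 /inv_torus_sum (bigD1 1%g) ?perm_on1 //=.
  rewrite big1 ?addr0; last first.
    move=> w /andP[w0]; case/eqP; apply/permP => i; rewrite perm1.
    by apply: (out_perm w0); rewrite inE.
  rewrite /b big_ord0 mul1r; apply: invr_inj; rewrite invrK invr1.
  have := sum_torus_order (w := 1%g) (A := set0) (perm_on1 _).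
  rewrite cards0 expn0 (bigD1 set0) /=; last first.
    by rewrite sub0set; apply/forallP => i; rewrite !inE.
  rewrite big1 ?addn0; first by move=> ->.
  by move=> U /andP[/andP[]]; rewrite subset0 => ->.
apply: (mulfI (card_exp_sub1_neq0 #|A|.-1)); rewrite prednK // mulrBl mul1r.
rewrite inv_torus_sum_rec (bigD1 finset.set0) ?finset.sub0set //= cards0.
rewrite finset.setD0 mul1r addrAC subrr add0r.
rewrite [RHS]mulrCA torus_mass_sum.
transitivity (\sum_(U : {set 'I_n} | (U \subset A) && (U != set0))
   ((#|U|)`!)%:R * ((#|A| - #|U|)`!)%:R * b (#|A| - #|U|) : rat).
  apply: eq_bigr => U /andP[UA U0].
  have cD : #|A :\: U| = (#|A| - #|U|)%N by rewrite cardsD (setIidPr UA).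
  rewrite IHm cD ?mulrA //; apply: leq_trans Am.
  by rewrite -subn_gt0 subKn ?subset_leq_card // card_gt0.
(* inord is exact here, since |U| <= |A|; index 0 would be U = set0. *)
rewrite (partition_big (fun U : {set 'I_n} => inord #|U| : 'I_#|A|.+1) predT) //=.
rewrite big_ord_recl /= big1 ?add0r; last first.
  move=> U /andP[/andP[UA U0] /eqP /(congr1 val)].
  by rewrite /= inordK ?ltnS ?subset_leq_card // => /eqP; rewrite cards_eq0 (negPf U0).
rewrite [in RHS](reindex_inj rev_ord_inj) /= mulr_sumr; apply: eq_bigr => k _.
have lek : (k < #|A|)%N by [].
rewrite (eq_bigr (fun=> (k.+1`!)%:R * ((#|A| - k.+1)`!)%:R * b (#|A| - k.+1))); last first.
  move=> U /andP[/andP[UA U0] /eqP /(congr1 val)].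
  by rewrite /= inordK ?ltnS ?subset_leq_card // => ->.
rewrite sumr_const -[LHS]mulr_natl mulrA; congr (_ * _).
rewrite (_ : #|_| = 'C(#|A|, k.+1)); first by rewrite -!natrM bin_fact.
rewrite -cards_draws; apply: eq_card => U; rewrite !inE [in LHS]unfold_in /=.
have [UA|] /= := boolP (U \subset A); last by [].
have [->|U0] := eqVneq U finset.set0; first by rewrite cards0.
by rewrite -[inord _ == _]/(val _ == val _) /= inordK ?ltnS ?subset_leq_card.
Qed.

End TorusOrders.

(** * Split tori as stabilizers of frames *)

Local Open Scope classical_set_scope.

Section RegularEntries.
Import mpoly.

(** Makes conjugation by a fixed matrix a morphism of algebraic groups, and
    being diagonal after conjugation a closed condition. *)
Lemma linear_entry_regular (K : closedFieldType) (n : nat) (U V : 'M[K]_n) i j :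
  exists P : mpoly.mpoly (n * n) K, forall A, regfun P 0 A = (U *m A *m V) i j.
Proof.
exists (\sum_(k < n) \sum_(l < n)
  ((U i k * V l j) *: mpoly.mpolyX K (mpoly.mnm1 (mxvec_index k l)))) => A.
rewrite /regfun expr0 divr1 raddf_sum /= mxE.
rewrite [RHS](eq_bigr (fun l => \sum_k U i k * A k l * V l j)); last first.
  by move=> l _; rewrite mxE mulr_suml.
rewrite [RHS]exchange_big; apply: eq_bigr => k _; rewrite raddf_sum /=.
by apply: eq_bigr => l _; rewrite mpoly.mevalZ mpoly.mevalXU mxvecE mulrAC.
Qed.
End RegularEntries.

Section EigenTori.
Variables (K : closedFieldType) (n : nat).
Implicit Types (g h A B : 'M[K]_n) (T : set 'M[K]_n).

(** The split torus with the rows of g as eigenlines, described without the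
    inverse of g. *)
Definition eigen_torus g : set 'M[K]_n :=
  [set A | GL A /\ exists d : 'rV[K]_n, g *m A = diag_mx d *m g].

Lemma GLE A : GL A = (A \in unitmx :> Prop). Proof. by []. Qed.

Lemma eigen_torus_closed g : g \in unitmx -> zariski_closed (eigen_torus g).
Proof.
move=> gU.
exists [set f | f.2 = 0%N /\ exists i j : 'I_n, i != j /\
  forall A, regfun f.1 f.2 A = (g *m A *m invmx g) i j].
apply/seteqP; split=> A [AU]; rewrite /= => H; split=> //.
  case: H => d gA [P e] [/= -> [i [j [ij ->]]]].
  by rewrite gA mulmxK // mxE (negPf ij).
have /is_diag_mxP/diag_mxP[d gAg] : forall i j : 'I_n,
    i != j :> nat -> (g *m A *m invmx g) i j = 0.
  move=> i j ij; have [P PE] := linear_entry_regular g (invmx g) i j.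
  by rewrite -PE; apply: (H (P, 0%N)); split=> //; exists i, j.
by exists d; rewrite -gAg mulmxKV.
Qed.

Lemma diag_mx_unit (d : 'rV[K]_n) : (diag_mx d \in unitmx) = [forall i, d 0 i != 0].
Proof.
rewrite unitmxE det_diag unitfE; apply/prodf_neq0/forallP => H i //.
exact: H.
Qed.

Lemma eigen_torus_conj g A : g \in unitmx -> eigen_torus g A ->
  diag_group (g *m A *m invmx g).
Proof.
move=> gU [AU [d gA]]; split; last by rewrite gA mulmxK // diag_mx_is_diag.
by rewrite GLE !unitmx_mul unitmx_inv gU AU.
Qed.

Lemma diag_group_conj g A : g \in unitmx -> diag_group A ->
  eigen_torus g (invmx g *m A *m g).
Proof.
move=> gU [AU /diag_mxP[d dE]]; split; first by rewrite GLE !unitmx_mul unitmx_inv gU AU.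
by exists d; rewrite !mulmxA mulmxV // mul1mx dE.
Qed.

Lemma diag_group_invmx A : diag_group A -> diag_group (invmx A).
Proof.
move=> [AU /diag_mxP[d dE]]; split; first by rewrite GLE unitmx_inv.
move: AU; rewrite GLE dE diag_mx_unit => /forallP d0.
have dd : diag_mx d *m diag_mx (\row_i (d 0 i)^-1) = 1%:M.
  rewrite mulmx_diag -diag_const_mx; congr diag_mx; apply/rowP => i.
  by rewrite !mxE mulfV.
have dU := (mulmx1_unit dd).1.
by rewrite -[invmx _]mulmx1 -dd mulKmx // diag_mx_is_diag.
Qed.

Lemma diag_groupM A B : diag_group A -> diag_group B -> diag_group (A *m B).
Proof.
move=> [AU /diag_mxP[d dE]] [BU /diag_mxP[e eE]].
by split; rewrite ?GLE ?unitmx_mul ?AU ?BU // dE eE mulmx_diag diag_mx_is_diag.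
Qed.

Lemma conjM g A B : g \in unitmx ->
  g *m (A *m B) *m invmx g = (g *m A *m invmx g) *m (g *m B *m invmx g).
Proof. by move=> gU; rewrite !mulmxA mulmxKV. Qed.

Lemma eigen_torusE g A : g \in unitmx ->
  eigen_torus g A <-> diag_group (g *m A *m invmx g).
Proof.
move=> gU; split; first exact: eigen_torus_conj.
by move/(diag_group_conj gU); rewrite !mulmxA mulVmx // mul1mx mulmxKV.
Qed.

Lemma eigen_torus_subgroup g : g \in unitmx -> subgroup (eigen_torus g).
Proof.
move=> gU; split.
- by move=> A [].
- apply/eigen_torusE => //; rewrite mulmx1 mulmxV //; split; first by rewrite GLE unitmx1.
  by rewrite -diag_const_mx diag_mx_is_diag.
- move=> A B /(eigen_torusE _ gU) gA /(eigen_torusE _ gU) gB.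
  by apply/eigen_torusE => //; rewrite conjM //; apply: diag_groupM.
- move=> A AT; have AU : A \in unitmx by case: AT.
  apply/eigen_torusE => //; move/(eigen_torusE _ gU)/diag_group_invmx: AT.
  set C := g *m A *m invmx g => dC.
  have CU : C \in unitmx by rewrite !unitmx_mul gU AU unitmx_inv.
  suff -> : g *m invmx A *m invmx g = invmx C by [].
  rewrite -[LHS](mulKmx CU) /C -conjM // mulmxV // mulmx1 mulmxV //.
  by rewrite mulmx1.
Qed.

Lemma eigen_torus_torus g : g \in unitmx -> torus (eigen_torus g).
Proof.
move=> gU; split; first by split; [exact: eigen_torus_closed | exact: eigen_torus_subgroup].
have VU : invmx g \in unitmx by rewrite unitmx_inv.
exists n, (fun A => g *m A *m invmx g), (fun A => invmx g *m A *m g); split.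
- split; first by move=> A; apply: eigen_torus_conj.
    by move=> A B _ _; apply: conjM.
  by move=> i j; have [P PE] := linear_entry_regular g (invmx g) i j; exists P, 0%N.
- split; first by move=> A; apply: diag_group_conj.
    by move=> A B _ _; have := conjM A B VU; rewrite invmxK.
  by move=> i j; have [P PE] := linear_entry_regular (invmx g) g i j; exists P, 0%N.
- by move=> A _; rewrite !mulmxA mulVmx // mul1mx mulmxKV.
- by move=> A _; rewrite !mulmxA mulmxV // mul1mx mulmxK.
Qed.

Lemma distinct_nonzero_exists m :
  exists s : seq K, [/\ uniq s, size s = m & 0 \notin s].
Proof.
elim: m => [|m [s [us ss s0]]]; first by exists [::].
have /closed_nonrootP[x] : \prod_(a <- 0 :: s) ('X - a%:P) != 0 :> {poly K}.
  by rewrite monic_neq0 // monic_prod_XsubC.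
rewrite root_prod_XsubC inE negb_or => /andP[x0 xs].
by exists (x :: s); rewrite /= xs us ss inE negb_or eq_sym x0 s0.
Qed.

Lemma row_unit_neq0 A i : A \in unitmx -> exists j, A i j != 0.
Proof.
move=> AU; apply/existsP; apply: contraLR AU; rewrite negb_exists => /forallP Ai.
rewrite unitmxE (expand_det_row _ i) big1 ?unitr0 // => j _.
by have := Ai j; rewrite negbK => /eqP ->; rewrite mul0r.
Qed.

(** An element of [eigen_torus g] with pairwise distinct eigenvalues t has only
    the n eigenlines spanned by the rows of g, so the rows of h, being
    eigenvectors of it, lie on these lines. *)
Lemma eigen_torus_sub g h : g \in unitmx -> h \in unitmx ->
  eigen_torus g `<=` eigen_torus h ->
  exists (s : {perm 'I_n}) (d : 'I_n -> K), (forall i, d i != 0)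
    /\ forall i j, h i j = d i * g (s i) j.
Proof.
move=> gU hU gh; have [ts [uts sts ts0]] := distinct_nonzero_exists n.
pose t : 'rV[K]_n := \row_i ts`_i.
pose A := invmx g *m diag_mx t *m g.
have tU : diag_mx t \in unitmx.
  rewrite diag_mx_unit; apply/forallP => i; rewrite mxE.
  by apply: contraNneq ts0 => <-; rewrite mem_nth // sts.
have AT : eigen_torus g A by apply: diag_group_conj => //; split; rewrite ?diag_mx_is_diag.
have [_ [e hA]] := gh _ AT.
pose u := h *m invmx g.
have uU : u \in unitmx by rewrite unitmx_mul hU unitmx_inv.
have hu : h = u *m g by rewrite mulmxKV.
(* In coordinates, u_ij t_j = e_i u_ij leaves one nonzero entry in each row. *)
have ut : u *m diag_mx t = diag_mx e *m u.
  by rewrite /u mulmxA -hA /A !mulmxA mulmxK.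
have utE i j : u i j * t 0 j = e 0 i * u i j.
  by have /matrixP /(_ i j) := ut; rewrite mul_mx_diag mul_diag_mx !mxE.
have /fin_all_exists[s sE] := fun i => row_unit_neq0 i uU.
have eE i : e 0 i = t 0 (s i).
  by apply: (mulfI (sE i)); rewrite utE mulrC.
have u0 i j : j != s i -> u i j = 0.
  move=> js; apply/eqP; apply: contraNT js => uij; apply/eqP/val_inj/eqP.
  rewrite -(nth_uniq 0 _ _ uts) ?sts ?ltn_ord //.
  have := utE i j; rewrite eE [LHS]mulrC => /(mulIf uij).
  by rewrite !mxE => ->.
have sinj : injective s.
  move=> a a' ss; apply/eqP; apply: contraT => aa'.
  have uvE (k k' : 'I_n) : (k == k')%:R = u k (s k) * (invmx u) (s k) k'.
    have /matrixP /(_ k k') := mulmxV uU; rewrite [LHS]mxE [RHS]mxE => <-.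
    by rewrite (bigD1 (s k)) //= big1 ?addr0 // => b bs; rewrite u0 // mul0r.
  have := uvE a a'; rewrite (negPf aa') => /esym /eqP.
  rewrite mulf_eq0 (negPf (sE a)) /= => /eqP v0.
  by have /eqP := uvE a' a'; rewrite -ss v0 mulr0 eqxx oner_eq0.
exists (perm sinj), (fun i => u i (s i)); split=> [i|i j]; first exact: sE.
rewrite {1}hu mxE (bigD1 (s i)) //= big1 ?addr0 ?permE // => k ks.
by rewrite u0 // mul0r.
Qed.

Lemma eigen_torus_monomial g h (s : {perm 'I_n}) (d : 'I_n -> K) :
  (forall i, d i != 0) -> (forall i j, h i j = d i * g (s i) j) ->
  eigen_torus g = eigen_torus h.
Proof.
have sub g' h' (s' : {perm 'I_n}) (d' : 'I_n -> K) :
  (forall i j, h' i j = d' i * g' (s' i) j) -> eigen_torus g' `<=` eigen_torus h'.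
  move=> hg A [AU [e gA]]; split=> //; exists (\row_i e 0 (s' i)).
  apply/matrixP => i j; have /matrixP /(_ (s' i) j) := gA.
  rewrite !mul_diag_mx !mxE => gAij; rewrite hg mulrCA -gAij mulr_sumr.
  by apply: eq_bigr => k _; rewrite hg mulrA.
move=> d0 hg; apply/seteqP; split; first exact: sub hg.
apply: (sub _ _ (s^-1)%g (fun i => (d (s^-1 i)%g)^-1)) => i j.
by rewrite hg permKV mulKf.
Qed.

End EigenTori.

(** * Maximal tori over an algebraic closure of a finite field *)

Section MaximalTori.
Variables (Fq : finFieldType) (K : closedFieldType) (iota : {rmorphism Fq -> K}).
Local Notation q := #|Fq|.
Hypothesis hK : algebraic_closure iota.

Lemma frobX_inj k : injective (fun x : K => x ^+ (q ^ k)).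
Proof.
move=> x y xy; apply/eqP; rewrite -subr_eq0.
have qP := card_pchar_nat iota k.
have : (x - y) ^+ (q ^ k) == 0 by rewrite exprDn_pchar // exprNn_pchar // xy subrr.
by rewrite expf_eq0 => /andP[].
Qed.

(** If p is a nonzero polynomial over Fq that kills x, each power of x is the value
    at x of one of finitely many remainders modulo p; so two of the x^(q^i)
    coincide, and the Frobenius is injective. *)
Lemma algebraic_frob_fixed (x : K) : exists2 k, (0 < k)%N & x ^+ (q ^ k) = x.
Proof.
have [p p0 px] := hK x.
have evE (r : {poly Fq}) : (map_poly iota (r %% p)).[x] = (map_poly iota r).[x].
  by rewrite {2}(divp_eq r p) rmorphD rmorphM /= hornerD hornerM (eqP px) mulr0 add0r.
pose d := (size p).-1.
pose f (i : 'I_#|{: 'rV[Fq]_d}|.+1) : 'rV[Fq]_d := poly_rV ('X^(q ^ i) %% p).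
have /injectivePn[i [j ij fij]] : ~~ injectiveb f.
  by apply/negP => /injectiveP /leq_card; rewrite card_ord ltnn.
have xE (k : 'I__) : x ^+ (q ^ k) = (map_poly iota (rVpoly (f k))).[x].
  rewrite poly_rV_K; first by rewrite evE map_polyXn hornerXn.
  by rewrite /d -ltnS prednK ?ltn_modp // size_poly_gt0.
have xij : x ^+ (q ^ i) = x ^+ (q ^ j) by rewrite !xE fij.
wlog lij : i j ij fij xij / (i < j)%N.
  move=> W; have [/W|/W|E] := ltngtP i j; [exact | apply=> //; first by rewrite eq_sym |].
  by case/eqP: ij; apply: val_inj.
exists (j - i)%N; first by rewrite subn_gt0.
by apply: (@frobX_inj i); rewrite /= -exprM -expnD subnK ?xij // ltnW.
Qed.

Lemma common_frob_fixed m (d : 'I_m -> K) :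
  exists2 k, (0 < k)%N & forall i, d i ^+ (q ^ k) = d i.
Proof.
have /fin_all_exists[k kP] i : exists k, (0 < k)%N /\ d i ^+ (q ^ k) = d i.
  by have [k k0 kE] := algebraic_frob_fixed (d i); exists k.
exists (\prod_i k i)%N => [|i]; first by apply: prodn_gt0 => i; case: (kP i).
rewrite (bigD1 i) //=; move: (\prod_(_ | _) _)%N => c.
by elim: c => [|c IHc]; rewrite ?muln0 ?expr1 // mulnS expnD exprM (kP i).2 IHc.
Qed.

(** The isomorphism with a diagonal group makes T commutative and every element
    of T a root of some X^Q - X, which has simple roots.  Simultaneous
    diagonalization of finitely many matrices is enough, since T lies in the
    linear span of a finite subset. *)
Lemma torus_sub_eigen n (T : set 'M[K]_n) : (0 < n)%N -> torus T ->
  exists2 g, g \in unitmx & T `<=` eigen_torus g.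
Proof.
case: n T => // n T _ [[_ [TGL T1 TM TV]] [r [phi [psi [phiM psiM psiK phiK]]]]].
case: phiM => phiT phiM _; case: psiM => _ psiM _.
have comT A B : T A -> T B -> comm_mx A B.
  move=> TA TB; rewrite /comm_mx -[LHS]psiK ?phiM //; last exact: TM.
  have [_ /diag_mxP[d dE]] := phiT _ TA; have [_ /diag_mxP[e eE]] := phiT _ TB.
  by rewrite dE eE diag_mxC -dE -eE -phiM // psiK //; apply: TM.
have powT A m : T A -> T (A ^+ m.+1) /\ phi (A ^+ m.+1) = phi A ^+ m.+1.
  move=> TA; elim: m => [|m [TAm phiAm]]; first by rewrite !expr1.
  rewrite exprS [RHS]exprS; split; first exact: TM.
  by rewrite phiM // phiAm.
have diagT A : T A -> diagonalizable A.
  move=> TA; have [_ /diag_mxP[d dE]] := phiT _ TA.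
  have [k k0 kE] := common_frob_fixed (fun i => d 0 i).
  have [s [us _ _ sprod]] := frob_roots_exist iota k0.
  have Q0 : (0 < q ^ k)%N by rewrite expn_gt0 (ltnW (finNzRing_gt1 Fq)).
  have AQ : A ^+ (q ^ k) = A.
    have [TAQ phiAQ] := powT A (q ^ k).-1 TA.
    rewrite prednK // in TAQ phiAQ; rewrite -[LHS]psiK // phiAQ -[RHS]psiK //.
    congr psi; rewrite dE.
    have diagX m : diag_mx d ^+ m = diag_mx (\row_i d 0 i ^+ m).
      elim: m => [|m IHm].
        rewrite expr0 -[1]/(1%:M) -diag_const_mx; congr diag_mx.
        by apply/rowP => i; rewrite !mxE.
      rewrite exprS IHm -[_ * _]/(_ *m _) mulmx_diag; congr diag_mx.
      by apply/rowP => i; rewrite !mxE exprS.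
    by rewrite diagX; congr diag_mx; apply/rowP => i; rewrite mxE kE.
  apply/diagonalizableP; exists s => //.
  rewrite sprod; apply: mxminpoly_min; rewrite rmorphB rmorphXn /= horner_mx_X.
  by rewrite AQ subrr.
(* A finite part of T whose span has the largest dimension. *)
have [As AsT Asmax] : exists2 As : seq 'M[K]_n.+1, (forall A, A \in As -> T A)
    & forall Bs, (forall A, A \in Bs -> T A) -> (\dim <<Bs>> <= \dim <<As>>)%N.
  pose P m := `[< exists2 As : seq 'M[K]_n.+1,
    (forall A, A \in As -> T A) & \dim <<As>> = m >].
  have P0 : exists m, P m.
    by exists 0%N; apply/asboolP; exists [::]; rewrite // span_nil dimv0.
  have Pmax m : P m -> (m <= \dim {: 'M[K]_n.+1})%N.
    by move=> /asboolP[As _ <-]; apply: dimvS; apply: subvf.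
  case: (ex_maxnP P0 Pmax) => m /asboolP[As AsT <-] mmax.
  by exists As => // Bs BsT; apply: mmax; apply/asboolP; exists Bs.
have [g gU gAs] : codiagonalizable As.
  apply/codiagonalizableP; split=> [A B /AsT TA /AsT TB|A /AsT]; first exact: comT.
  exact: diagT.
exists g => // A TA; apply/eigen_torusE => //; split.
  by rewrite GLE !unitmx_mul unitmx_inv gU TGL.
have AAs : A \in <<in_tuple As>>%VS.
  have : (<<As>> == <<A :: As>>)%VS.
    rewrite eqEdim Asmax ?andbT; last by move=> B; rewrite inE => /predU1P[->|/AsT].
    by apply: sub_span => B BAs; rewrite inE BAs orbT.
  by move/eqP ->; apply: memv_span; rewrite inE eqxx.
apply/is_diag_mxP => i j ij; rewrite (coord_span AAs) mulmx_sumr mulmx_suml summxE.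
rewrite big1 // => k _; rewrite -scalemxAr -scalemxAl mxE.
have kAs : (in_tuple As)`_k \in As by rewrite mem_nth.
have /allP /(_ _ kAs) /(diagonalizable_forP _ gU) -> // := gAs.
by rewrite mulr0.
Qed.

Variable n : nat.
Hypothesis n_gt0 : (0 < n)%N.
Implicit Types (g h : 'M[K]_n) (T : set 'M[K]_n).
Local Notation Fr := (@frobenius K q n).

Lemma maximal_torusP T :
  maximal_torus T <-> exists2 g, g \in unitmx & T = eigen_torus g.
Proof.
split=> [[tT maxT]|[g gU ->]].
  have [g gU Tg] := torus_sub_eigen n_gt0 tT; exists g => //.
  by rewrite (maxT _ (eigen_torus_torus gU)).
split=> [|T' tT' gT']; first exact: eigen_torus_torus.
have [h hU T'h] := torus_sub_eigen n_gt0 tT'.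
have [s [d [d0 hE]]] := eigen_torus_sub gU hU (classical_sets.subset_trans gT' T'h).
by apply/seteqP; split=> //; rewrite (eigen_torus_monomial d0 hE).
Qed.

Lemma frobenius_eigen_torus g : g \in unitmx ->
  Fr @` eigen_torus g = eigen_torus (Fr g).
Proof.
move=> gU.
have FE m p (A : 'M[K]_(m, p)) :
  map_mx (fun x => x ^+ q) A = map_mx (frob iota) A by [].
have Fsurj (x : K) : exists y, y ^+ q = x.
  have q_gt1 := finNzRing_gt1 Fq.
  have /closed_rootP[y] : size ('X^q - x%:P) != 1%N.
    by rewrite size_XnsubC ?gtn_eqF // ltnW.
  by rewrite /root !hornerE subr_eq0 => /eqP; exists y.
have FU A : (Fr A \in unitmx) = (A \in unitmx).
  by rewrite /frobenius FE map_unitmx.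
apply/seteqP; split=> [_ [A [AU [d gA]] <-]|B [BU [e gB]]].
  split; first by rewrite GLE FU.
  exists (map_mx (frob iota) d).
  by rewrite /frobenius !FE -map_diag_mx -!map_mxM gA.
have /fin_all_exists[d dE] i := Fsurj (e 0 i).
pose D : 'rV[K]_n := \row_i d i.
have FD : map_mx (frob iota) D = e by apply/rowP => i; rewrite !mxE -dE.
pose A := invmx g *m diag_mx D *m g.
have FA : Fr A = B.
  apply: (can_inj (mulKmx (_ : Fr g \in unitmx))); first by rewrite FU.
  rewrite gB /frobenius !FE -map_mxM /A !mulmxA mulmxV // mul1mx map_mxM map_diag_mx.
  by rewrite FD.
exists A => //; split; first by rewrite GLE -FU FA.
by exists D; rewrite !mulmxA mulmxV // mul1mx.
Qed.

(** The torus is F-stable when the Frobenius permutes the lines spanned by the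
    rows of g; [torus_lang] then chooses generators of these lines that are
    permuted themselves. *)
Lemma F_stable_maximal_torusP T : maximal_torus T /\ F_stable q T <->
  exists (w : {perm 'I_n}) g, [/\ g \in unitmx,
    forall i j, g (w i) j = g i j ^+ q & T = eigen_torus g].
Proof.
have FU g : g \in unitmx -> Fr g \in unitmx.
  by move=> gU; rewrite -[Fr g]/(map_mx (frob iota) g) map_unitmx.
split=> [[/maximal_torusP[g gU ->]]|[w [g [gU gw ->]]]].
  rewrite /F_stable frobenius_eigen_torus // => E.
  have [w [d [d0 dE]]] : exists (s : {perm 'I_n}) (d : 'I_n -> K),
      (forall i, d i != 0)
      /\ forall i j, Fr g i j = d i * g (s i) j.
    by apply: eigen_torus_sub => //; [exact: FU | rewrite E].
  have [f [f0 fw]] := torus_lang w (finNzRing_gt1 Fq) d0.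
  pose h := diag_mx (\row_i f i) *m g.
  have hE i j : h i j = f i * g i j by rewrite /h mul_diag_mx !mxE.
  exists w, h; split.
  - rewrite unitmx_mul gU andbT diag_mx_unit.
    by apply/forallP => i; rewrite mxE.
  - by move=> i j; rewrite !hE fw exprMn mulrAC -dE mxE mulrC.
  - by apply: (@eigen_torus_monomial _ _ g h 1%g f f0) => i j; rewrite perm1.
split; first by apply/maximal_torusP; exists g.
rewrite /F_stable frobenius_eigen_torus //; apply/esym.
apply: (eigen_torus_monomial (s := w) (d := fun=> 1)) => i; first exact: oner_neq0.
by move=> j; rewrite mxE mul1r gw.
Qed.

End MaximalTori.

(** * Counting F-stable maximal tori *)

Section Counting.
Variables (Fq : finFieldType) (K : closedFieldType) (iota : {rmorphism Fq -> K}).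
Local Notation q := #|Fq|.
Hypothesis hK : algebraic_closure iota.
Variables (n : nat) (rs : seq K).
Hypothesis n_gt0 : (0 < n)%N.
Hypothesis rsP : forall x, (x \in rs) = (x ^+ (q ^ n`!) == x).
Local Notation L := (seq_sub rs).
Local Notation pairL := ({perm 'I_n} * 'M[L]_n)%type.
Implicit Types (w s : {perm 'I_n}) (p : pairL).

Definition tori_frames : {set pairL} :=
  finset (fun p : pairL => p.2 \in twisted_units Fq rs p.1).

Definition frame_torus p : set 'M[K]_n := eigen_torus (map_mx val p.2).

Lemma scaled_rows_inj (g : 'M[K]_n) i k (a b : K) : g \in unitmx -> a != 0 ->
  (forall j, a * g i j = b * g k j) -> i = k /\ a = b.
Proof.
move=> gU a0 ab.
have abE l : a * (i == l)%:R = b * (k == l)%:R.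
  have gE (m m' : 'I_n) : (m == m')%:R = \sum_j g m j * invmx g j m'.
    by have /matrixP /(_ m m') := mulmxV gU; rewrite [LHS]mxE [RHS]mxE.
  rewrite !gE !mulr_sumr; apply: eq_bigr => j _.
  by rewrite !mulrA ab.
have := abE i; rewrite eqxx mulr1; have [->|_] := eqVneq k i.
  by rewrite mulr1.
by rewrite mulr0 => a00; rewrite a00 eqxx in a0.
Qed.

Lemma tori_framesP p : p \in tori_frames <->
  map_mx val p.2 \in unitmx
  /\ forall i j, val (p.2 (p.1 i) j) = val (p.2 i j) ^+ q.
Proof.
rewrite !inE; split=> [/andP[gU /forallP gw]|[gU gw]].
  by split=> // i j; apply/eqP/(forallP (gw i)).
by rewrite gU; apply/forallP => i; apply/forallP => j; rewrite gw.
Qed.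

Lemma mem_rsM x y : x \in rs -> y \in rs -> x * y \in rs.
Proof. by rewrite !rsP exprMn => /eqP-> /eqP->. Qed.

(** The fibre over the torus of (w0, g0) consists of the pairs obtained by
    reordering the rows of g0 by s, which turns w0 into its conjugate, and
    scaling them by a point f of the corresponding finite torus.  For each of the
    n! choices of s the weights of the choices of f add up to 1 / n!. *)
Lemma fiber_weight (p0 : pairL) : p0 \in tori_frames ->
  \sum_(p in tori_frames | frame_torus p == frame_torus p0)
    ((n`!)%:R * (torus_order Fq rs finset.setT p.1)%:R)^-1 = 1 :> rat.
Proof.
case: p0 => w0 g0 p0F; have [/= g0U g0w] := (tori_framesP _).1 p0F.
pose conjw s : {perm 'I_n} := (s * w0 * s^-1)%g.
pose H (a : {perm 'I_n} * {ffun 'I_n -> L}) : pairL :=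
  (conjw a.1,
   \matrix_(i, j) SeqSub (mem_rsM (ssvalP (a.2 i)) (ssvalP (g0 (a.1 i) j)))).
have HE a i j : val ((H a).2 i j) = val (a.2 i) * val (g0 (a.1 i) j) by rewrite mxE.
pose D : {set {perm 'I_n} * {ffun 'I_n -> L}} := finset (fun a =>
  (a.2 \in fixpts Fq rs (conjw a.1)) && (supp a.2 == finset.setT)).
have nz (f : {ffun 'I_n -> L}) i : supp f = finset.setT -> val (f i) != 0.
  move=> fT; have : i \in supp f by rewrite fT inE.
  by rewrite inE.
have Hinj : {in D &, injective H}.
  move=> [s f] [s' f']; rewrite !inE /= => /andP[_ /eqP fT] _ [_ /matrixP E].
  have sf i : s i = s' i /\ val (f i) = val (f' i).
    apply: (scaled_rows_inj g0U (nz f i fT)) => j.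
    by have /(congr1 val) := E i j; rewrite !mxE.
  congr (_, _); first by apply/permP => i; case: (sf i).
  by apply/ffunP => i; apply: val_inj; case: (sf i).
have HD : [set p in tori_frames | frame_torus p == frame_torus (w0, g0)]%SET
    = (H @: D)%SET.
  apply/setP => p; rewrite inE; apply/andP/imsetP => [[pF /eqP pT]|[[s f]]].
    have [gU gw] := (tori_framesP _).1 pF.
    have [s [d [d0 dE]]] : exists s (d : 'I_n -> K), (forall i, d i != 0) /\
        forall i j, map_mx val p.2 i j = d i * map_mx val g0 (s i) j.
      apply: eigen_torus_sub => //.
      by rewrite -[X in X `<=` _]/(frame_torus (w0, g0)) -pT.
    have sw i : s (p.1 i) = w0 (s i) /\ d (p.1 i) = d i ^+ q.
      apply: (scaled_rows_inj g0U (d0 _)) => j; rewrite -dE !mxE gw.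
      by have := dE i j; rewrite !mxE g0w => ->; rewrite exprMn.
    have wE : p.1 = conjw s.
      by apply/permP => i; rewrite !permM -(sw i).1 permK.
    have [f fw fE] := @fixptsP Fq K n rs rsP p.1 d (fun i => (sw i).2).
    exists (s, f).
      rewrite inE /= -wE fw; apply/eqP/setP => i; rewrite !inE fE; exact: d0.
    rewrite [LHS]surjective_pairing [RHS]surjective_pairing; congr (_, _) => //.
    apply/matrixP => i j; apply: val_inj; rewrite HE fE /=.
    by have := dE i j; rewrite !mxE.
  rewrite inE /= => /andP[fw /eqP fT] ->.
  have gE : forall i j, map_mx val (H (s, f)).2 i j = val (f i) * map_mx val g0 (s i) j.
    by move=> i j; rewrite ![map_mx _ _ _ _]mxE HE.
  split; last first.
    apply/eqP/esym; apply: (eigen_torus_monomial _ gE) => i; exact: nz.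
  apply/tori_framesP; split; last first.
    move=> i j; rewrite !HE /= (fixpts_eq _ fw) exprMn -g0w.
    by rewrite /conjw !permM permKV.
  have -> : map_mx val (H (s, f)).2
      = diag_mx (\row_i val (f i)) *m row_perm s (map_mx val g0).
    by apply/matrixP => i j; rewrite gE mul_diag_mx !mxE.
  rewrite unitmx_mul row_permE unitmx_mul unitmx_perm g0U andbT diag_mx_unit andbT.
  by apply/forallP => i; rewrite mxE nz.
transitivity (\sum_(p in (H @: D)%SET)
    ((n`!)%:R * (torus_order Fq rs finset.setT p.1)%:R)^-1 : rat).
  by apply: eq_bigl => p; rewrite -HD !inE.
rewrite big_imset //=.
rewrite (eq_bigl (fun a : {perm 'I_n} * {ffun 'I_n -> L} => true &&
   (a.2 \in [set f in fixpts Fq rs (conjw a.1) | supp f == finset.setT]%SET))); last first.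
  by move=> a; rewrite !inE.
rewrite -(pair_big_dep predT (fun s (f : {ffun 'I_n -> L}) =>
  f \in [set f in fixpts Fq rs (conjw s) | supp f == finset.setT]%SET)
  (fun s f => ((n`!)%:R * (torus_order Fq rs finset.setT (conjw s))%:R)^-1)) /=.
transitivity (\sum_(s : {perm 'I_n}) (n`!)%:R^-1 : rat).
  apply: eq_bigr => s _; rewrite sumr_const.
  rewrite -[#|_|]/(torus_order Fq rs finset.setT (conjw s)) -[LHS]mulr_natl invfM.
  rewrite mulrCA mulfV ?mulr1 // pnatr_eq0 -lt0n; apply: torus_order_gt0 => //.
  by apply/forallP => i; rewrite !inE.
rewrite sumr_const -[LHS]mulr_natl (_ : #|_| = n`!); last first.
  by rewrite -card_Sn; apply: eq_card.
by rewrite mulfV // pnatr_eq0 -lt0n fact_gt0.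
Qed.

(** Give each pair (w, g) the inverse of n! |T_w| as weight: every fibre has total
    weight 1, so the number of tori is the sum of all the weights. *)
Lemma F_stable_tori_seq : exists2 s : seq (set 'M[K]_n), uniq s &
  [set T | maximal_torus T /\ F_stable q T] = [set` s]
  /\ (size s)%:R = \sum_(w : {perm 'I_n})
     #|twisted_units Fq rs w|%:R
       / ((n`!)%:R * (torus_order Fq rs finset.setT w)%:R) :> rat.
Proof.
pose s := undup [seq frame_torus p | p <- enum tori_frames].
exists s; first exact: undup_uniq.
split.
  apply/seteqP; split=> T.
    move=> /(F_stable_maximal_torusP hK n_gt0)[w [g [gU gw ->]]].
    have grs i j : g i j \in rs by apply: (@twisted_in_rs Fq K n rs rsP w (g ^~ j)).
    pose gL : 'M[L]_n := \matrix_(i, j) SeqSub (grs i j).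
    have gLE : map_mx val gL = g by apply/matrixP => i j; rewrite !mxE.
    rewrite /= mem_undup; apply/mapP; exists (w, gL); last by rewrite /frame_torus gLE.
    rewrite mem_enum; apply/tori_framesP; rewrite gLE; split=> // i j.
    by rewrite !mxE /=; apply: gw.
  rewrite /= mem_undup => /mapP[p]; rewrite mem_enum => /tori_framesP[gU gw] ->.
  apply/(F_stable_maximal_torusP hK n_gt0); exists p.1, (map_mx val p.2); split=> // i j.
  by rewrite !mxE /=; apply: gw.
pose c p : rat := ((n`!)%:R * (torus_order Fq rs finset.setT p.1)%:R)^-1.
transitivity (\sum_(p in tori_frames) c p).
  transitivity (\sum_(T <- s) \sum_(p in tori_frames | frame_torus p == T) c p).
    rewrite -[LHS]mulr1n -sum1_size natr_sum big_seq [RHS]big_seq; apply: eq_bigr => T.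
    by rewrite mem_undup => /mapP[p]; rewrite mem_enum => pF ->; rewrite fiber_weight.
  rewrite (exchange_big_dep (mem tori_frames)) /=; last by move=> T p _ /andP[].
  apply: eq_bigr => p pF; rewrite (eq_bigl (pred1 (frame_torus p))); last first.
    by move=> T; rewrite pF eq_sym.
  have ps : frame_torus p \in s.
    by rewrite mem_undup; apply/mapP; exists p; rewrite // mem_enum.
  by rewrite big_const_seq count_uniq_mem ?undup_uniq // ps /= addr0.
rewrite (eq_bigl (fun p => true && (p.2 \in twisted_units Fq rs p.1))); last first.
  by move=> p; rewrite inE.
rewrite -(pair_big_dep predT (fun w (g : 'M[L]_n) => g \in twisted_units Fq rs w)
  (fun w g => c (w, g))) /=.
by apply: eq_bigr => w _; rewrite /c /= sumr_const -[LHS]mulr_natl.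
Qed.

Lemma sum_twisted_units_over_torus_order :
  \sum_(w : {perm 'I_n}) #|twisted_units Fq rs w|%:R
       / ((n`!)%:R * (torus_order Fq rs finset.setT w)%:R)
  = (q ^ (n ^ 2 - n))%:R :> rat.
Proof.
have q_gt1 := finNzRing_gt1 Fq.
rewrite (eq_bigr (fun w =>
   (q ^ 'C(n, 2) * \prod_(1 <= i < n.+1) (q ^ i - 1))%:R / (n`!)%:R
   * ((torus_order Fq rs finset.setT w)%:R)^-1)); last first.
  by move=> w _; rewrite (card_twisted_units iota rsP) // invfM mulrA.
have sumE : inv_torus_sum Fq rs (finset.setT : {set 'I_n})
    = \sum_(w : {perm 'I_n}) ((torus_order Fq rs finset.setT w)%:R)^-1.
  by apply: eq_bigl => w; apply/fintype.subsetP => i; rewrite inE.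
rewrite -mulr_sumr -sumE (inv_torus_sumE iota rsP).
rewrite cardsT card_ord mulrA divfK ?pnatr_eq0 -?lt0n ?fact_gt0 //.
rewrite natrM -mulrA big_add1 /= big_mkord natr_prod /torus_mass -big_split /=.
rewrite (eq_bigr (fun i : 'I_n => (q ^ i)%:R)); last first.
  move=> i _; rewrite natrB ?expn_gt0 ?(ltnW q_gt1) // mulrC divfK //.
  exact: card_exp_sub1_neq0.
rewrite -natr_prod -natrM; congr _%:R.
have -> : (\prod_(i < n) q ^ i = q ^ 'C(n, 2))%N by rewrite -bin2_sum big_mkord expn_sum.
rewrite -expnD; congr (_ ^ _)%N.
rewrite addnn -muln2 -[2%N]/(2`!)%N bin_ffact ffactnS ffactn1.
by rewrite -subn1 mulnBr muln1 mulnn.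
Qed.

End Counting.

Theorem theorem3p4 (q : nat) (hq : prime_power q) (n : nat) (hn : (1 <= n)%N)
  (Fq : finFieldType) (hFq : #|Fq| = q)
  (K : closedFieldType) (iota : {rmorphism Fq -> K})
  (hK : algebraic_closure iota) :
  ([set T : set 'M[K]_n | maximal_torus T /\ F_stable q T]
    #= `I_(q ^ (n ^ 2 - n)))%card.
Proof.
rewrite -hFq.
have [rs [_ _ rsP _]] := frob_roots_exist iota (fact_gt0 n).
have [s us [-> sz]] := F_stable_tori_seq hK hn rsP.
have {}sz : size s = (#|Fq| ^ (n ^ 2 - n))%N.
  apply/eqP; rewrite -(eqr_nat rat) sz; apply/eqP.
  exact: (sum_twisted_units_over_torus_order iota).
apply/card_set_bijP; exists (index ^~ s); split.
- by move=> T /= Ts; rewrite -sz index_mem.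
- move=> T T' /set_mem Ts /set_mem T's E.
  by rewrite -(nth_index T Ts) E nth_index.
- move=> i /=; rewrite -sz => si; exists (nth classical_sets.set0 s i) => /=.
    exact: mem_nth.
  exact: index_uniq.
Qed.
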